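(* Fix a prime $p$. Let $G=G_\Gamma$ be (the fundamental group of) a finite graph of finitely generated groups with vertex groups $\{G_v\}_{v\in V(\Gamma)}$ and edge groups $\{G_e\}_{e\in E(\Gamma)}$ satisfying the following conditions: (1) For each $v\in V(\Gamma)$, the group $G_v$ is RFR$p$. (2) For each $v\in V(\Gamma)$, the RFR$p$ topology on $G$ induces the RFR$p$ topology on $G_v$. (3) For each $e\in E(\Gamma)$ and each endpoint $v\in e$, the image of $G_e$ in $G_v$ given by the graph of groups structure of $G$ is closed in the RFR$p$ topology on $G_v$. Then $G$ is RFR$p$.
   Context: Let $p$ be a prime. A finitely generated group $G$ is residually finite rationally $p$ (RFR$p$) if there is a sequence of nested subgroups $G=G_1\geq G_2\geq\cdots$ such that: (i) $G_{i+1}$ is normal in $G_i$; (ii) $\bigcap_{i}G_i=\{1\}$; (iii) each $G_i/G_{i+1}$ is an elementary abelian $p$-group; (iv) $\ker\{G_i\to H_1(G_i,\mathbb{Q})\}<G_{i+1}$. The standard RFR$p$ filtration of a finitely generated group $G$ is $G_1=G$, $G_{i+1}=\ker\{G_i\to \mathrm{TFr}\,H_1(G_i,\mathbb{Z})\otimes\mathbb{Z}/p\mathbb{Z}\}$, where $\mathrm{TFr}(K)=K/\mathrm{Tors}(K)$. The RFR$p$ topology on $G$ has these subgroups as a neighborhood basis of the identity, and their cosets as a basis. A subgroup $H<G$ is closed in it if and only if for each $g\in G\setminus H$ there is $i$ such that the image of $g$ in $G/G_i$ does not lie in the image of $H$. If $H<G$ is a finitely generated subgroup with standard RFR$p$ filtration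 $\{H_j\}$, then $G$ induces the RFR$p$ topology on $H$ if for each $j$ there is an $i$ with $G_i\cap H<H_j$. For a vertex group $G_v$ this is understood via the canonical map $G_v\to G$ (with $G_i\cap G_v$ meaning the preimage of $G_i$ in $G_v$). A finite graph of groups consists of a finite connected graph $\Gamma$ (not necessarily simplicial), groups $G_v$ and $G_e$, and for each edge $e$ with endpoints $s,t$ homomorphisms $\phi_{e,s}\colon G_e\to G_s$ and $\phi_{e,t}\colon G_e\to G_t$, which are not required to be injective. The group $G_\Gamma$ is, for a maximal tree $T\subset\Gamma$, generated by the groups $G_v$ and letters $\tau_e$ ($e\in E(\Gamma)$), subject to $\tau_e\,\phi_{e,s}(c)\,\tau_e^{-1}=\phi_{e,t}(c)$ for all $c\in G_e$, and $\tau_e=1$ for $e\in E(T)$. *)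

(* Defs.v *)
From HB Require Import structures.
From mathcomp Require Import all_boot all_algebra.
From mathcomp Require Import boolp classical_sets.
From mathcomp Require Import topology_structure.

Set Implicit Arguments.
Unset Strict Implicit.
Unset Printing Implicit Defensive.

Local Open Scope classical_set_scope.
Local Open Scope group_scope.

(** * Subgroups of a possibly infinite group *)

Record subgroup (G : groupType) := Subgroup {
  sg_set :> G -> Prop;
  sg_one : sg_set 1;
  sg_div : forall x y, sg_set x -> sg_set y -> sg_set (x / y) }.

Section Subgroup.
Variables (G : groupType) (K : subgroup G).

Lemma sg_inv x : K x -> K x^-1.
Proof. by move=> Kx; rewrite -[x^-1]mul1g; apply: sg_div => //; exact: sg_one. Qed.

Lemma sg_mul x y : K x -> K y -> K (x * y).
Proof. by move=> Kx Ky; rewrite -[y]invgK; apply: sg_div => //; exact: sg_inv. Qed.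

Definition subg : Type := {x : G | x \in (K : set G)}.

HB.instance Definition _ := SubChoice.on subg.

Fact subg_closed : group_closed (fun x : G => x \in (K : set G)).
Proof.
split=> [|x y Kx Ky]; apply/mem_set; first exact: sg_one.
by apply: sg_div; apply/set_mem.
Qed.

HB.instance Definition _ := SubChoice_isSubGroup.Build G _ subg subg_closed.

End Subgroup.

Definition sg_full (G : groupType) : subgroup G :=
  @Subgroup G setT Logic.I (fun _ _ _ _ => Logic.I).

Section Morphisms.
Variables (G H : groupType) (f : {multiplicative G -> H}).

Fact mult1 : f 1 = 1.
Proof. by apply: (mulgI (f 1)); rewrite -gmulfM !mulg1. Qed.

Fact multF x y : f (x / y) = f x / f y.
Proof.
rewrite gmulfM; congr (_ * _); apply: (mulgI (f y)).
by rewrite -gmulfM !mulgV mult1.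
Qed.

Fact preim_div (K : subgroup H) x y :
  (f @^-1` K) x -> (f @^-1` K) y -> (f @^-1` K) (x / y).
Proof. by rewrite /preimage /= multF; exact: sg_div. Qed.

Fact preim_one (K : subgroup H) : (f @^-1` K) 1.
Proof. by rewrite /preimage /= mult1; exact: sg_one. Qed.

Definition sg_preim (K : subgroup H) : subgroup G :=
  Subgroup (preim_one K) (@preim_div K).

Fact ker_div x y :
  [set z | f z = 1] x -> [set z | f z = 1] y -> [set z | f z = 1] (x / y).
Proof. by rewrite /= multF => -> ->; rewrite divgg. Qed.

Definition ker : subgroup G := Subgroup (mult1 : [set z | f z = 1] 1) ker_div.

Fact im_one (K : subgroup G) : (f @` K) 1.
Proof. by exists 1; [exact: sg_one | exact: mult1]. Qed.

Fact im_div (K : subgroup G) x y :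
  (f @` K) x -> (f @` K) y -> (f @` K) (x / y).
Proof.
by move=> [a Ka <-] [b Kb <-]; exists (a / b); [exact: sg_div | exact: multF].
Qed.

Definition sg_im (K : subgroup G) : subgroup H :=
  Subgroup (im_one K) (@im_div K).

End Morphisms.

Section Generated.
Variables (G : groupType) (A : set G).

Definition gen_set : set G := [set x | forall K : subgroup G, A `<=` K -> K x].

Fact gen_one : gen_set 1.
Proof. by move=> K _; exact: sg_one. Qed.

Fact gen_div x y : gen_set x -> gen_set y -> gen_set (x / y).
Proof. by move=> Ax Ay K AK; apply: sg_div; [exact: Ax | exact: Ay]. Qed.

Definition gen : subgroup G := Subgroup gen_one gen_div.

End Generated.

Definition finitely_generated (G : groupType) : Prop :=
  exists s : seq G, gen [set` s] = setT :> set G.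

(** * Quotients *)

Definition normal (G : groupType) (N : subgroup G) : Prop :=
  forall x y, N x -> N (x ^ y).

Record normal_subgroup (G : groupType) := NormalSubgroup {
  ns_sg :> subgroup G;
  ns_normal : normal ns_sg }.

Section Quotient.
Variables (G : groupType) (N : normal_subgroup G).
Local Open Scope quotient_scope.

Definition coset_rel : rel G := fun x y => `[< N (x^-1 * y) >].

Fact coset_rel_refl : reflexive coset_rel.
Proof. by move=> x; apply/asboolP; rewrite mulVg; exact: sg_one. Qed.

Fact coset_rel_sym : symmetric coset_rel.
Proof.
by move=> x y; apply/asboolP/asboolP => /sg_inv; rewrite invgM invgK.
Qed.

Fact coset_rel_trans : transitive coset_rel.
Proof.
move=> y x z /asboolP Nxy /asboolP Nyz; apply/asboolP.
by have := sg_mul Nxy Nyz; rewrite mulgA mulgK.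
Qed.

Canonical coset_equiv :=
  EquivRel coset_rel coset_rel_refl coset_rel_sym coset_rel_trans.

Definition quotient : Type := {eq_quot coset_equiv}.

HB.instance Definition _ := Choice.on quotient.
HB.instance Definition _ := EqQuotient.on quotient.

Definition coset : G -> quotient := \pi_quotient.

Lemma cosetP x y : coset x = coset y <-> N (x^-1 * y).
Proof. by split=> [/eqquotP/asboolP | Nxy] //; apply/eqquotP/asboolP. Qed.

Lemma coset_repr (a : quotient) : coset (repr a) = a.
Proof. exact: reprK. Qed.

Let qmul (a b : quotient) : quotient := coset (repr a * repr b).
Let qinv (a : quotient) : quotient := coset (repr a)^-1.

Fact coset_mulE x y : qmul (coset x) (coset y) = coset (x * y).
Proof.
apply/cosetP; set a := repr _; set b := repr _.
have Na : N (a^-1 * x) by apply/cosetP; rewrite coset_repr.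
have Nb : N (b^-1 * y) by apply/cosetP; rewrite coset_repr.
have := sg_mul (ns_normal b Na) Nb.
by rewrite /conjg invgM !mulgA mulgK.
Qed.

Fact coset_invE x : qinv (coset x) = coset x^-1.
Proof.
apply/cosetP; set a := repr _.
have Na : N (x^-1 * a) by apply/cosetP; rewrite coset_repr.
by have := ns_normal x^-1 Na; rewrite /conjg !invgK !mulgA mulgV mul1g.
Qed.

Fact qmulA : associative qmul.
Proof.
move=> a b c; rewrite -(coset_repr a) -(coset_repr b) -(coset_repr c).
by rewrite !coset_mulE mulgA.
Qed.
Fact qmul1 : left_id (coset 1) qmul.
Proof. by move=> a; rewrite -(coset_repr a) coset_mulE mul1g. Qed.
Fact q1mul : right_id (coset 1) qmul.
Proof. by move=> a; rewrite -(coset_repr a) coset_mulE mulg1. Qed.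
Fact qmulV : left_inverse (coset 1) qinv qmul.
Proof. by move=> a; rewrite -(coset_repr a) coset_invE coset_mulE mulVg. Qed.
Fact qVmul : right_inverse (coset 1) qinv qmul.
Proof. by move=> a; rewrite -(coset_repr a) coset_invE coset_mulE mulgV. Qed.

HB.instance Definition _ :=
  isGroup.Build quotient qmulA qmul1 q1mul qmulV qVmul.

Fact cosetM : {morph coset : x y / x * y}.
Proof. by move=> x y; rewrite -coset_mulE. Qed.

HB.instance Definition _ := isMultiplicative.Build G quotient coset cosetM.

End Quotient.

(** * Groups given by generators and relations *)

Section Presentation.
Variable X : choiceType.
Local Open Scope quotient_scope.

(* The letter (x, false) stands for the generator x, (x, true) for its
   formal inverse. *)
Definition word := seq (X * bool).

Definition pos (x : X) : X * bool := (x, false).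
Definition neg (x : X) : X * bool := (x, true).

Definition inv_letter (a : X * bool) := (a.1, ~~ a.2).
Definition inv_word (w : word) : word := rev (map inv_letter w).

Variable R : word -> word -> Prop.

Inductive pres_eq : word -> word -> Prop :=
| Pres_relation u v of R u v : pres_eq u v
| Pres_cancel a : pres_eq [:: a; inv_letter a] [::]
| Pres_refl u : pres_eq u u
| Pres_sym u v of pres_eq u v : pres_eq v u
| Pres_trans u v w of pres_eq u v & pres_eq v w : pres_eq u w
| Pres_cat u u' v v' of pres_eq u u' & pres_eq v v' :
    pres_eq (u ++ v) (u' ++ v').

Definition pres_rel : rel word := fun u v => `[< pres_eq u v >].

Fact pres_rel_refl : reflexive pres_rel.
Proof. by move=> u; apply/asboolP; exact: Pres_refl. Qed.

Fact pres_rel_sym : symmetric pres_rel.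
Proof. by move=> u v; apply/asboolP/asboolP; exact: Pres_sym. Qed.

Fact pres_rel_trans : transitive pres_rel.
Proof.
by move=> v u w /asboolP uv /asboolP vw; apply/asboolP; exact: Pres_trans vw.
Qed.

Canonical pres_equiv :=
  EquivRel pres_rel pres_rel_refl pres_rel_sym pres_rel_trans.

Definition presented : Type := {eq_quot pres_equiv}.

HB.instance Definition _ := Choice.on presented.
HB.instance Definition _ := EqQuotient.on presented.

Definition pcl : word -> presented := \pi_presented.

Lemma pclP u v : pcl u = pcl v <-> pres_eq u v.
Proof. by split=> [/eqquotP/asboolP | uv] //; apply/eqquotP/asboolP. Qed.

Lemma pcl_repr (a : presented) : pcl (repr a) = a.
Proof. exact: reprK. Qed.

Lemma inv_letterK : involutive inv_letter.
Proof. by case=> x b; rewrite /inv_letter /= negbK. Qed.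

Lemma inv_wordK : involutive inv_word.
Proof.
by move=> w; rewrite /inv_word map_rev revK mapK //; exact: inv_letterK.
Qed.

Lemma inv_word_cat u v : inv_word (u ++ v) = inv_word v ++ inv_word u.
Proof. by rewrite /inv_word map_cat rev_cat. Qed.

Fact pres_mulV w : pres_eq (w ++ inv_word w) [::].
Proof.
elim: w => [|a w IHw]; first exact: Pres_refl.
rewrite -cat1s inv_word_cat catA -(catA [:: a]).
apply: Pres_trans (Pres_cancel a).
rewrite -[[:: a; inv_letter a]]/([:: a] ++ [:: inv_letter a]).
apply: Pres_cat; last exact: Pres_refl.
rewrite -[X in pres_eq _ X]cats0.
by apply: Pres_cat IHw; exact: Pres_refl.
Qed.

Fact pres_Vmul w : pres_eq (inv_word w ++ w) [::].
Proof. by have := pres_mulV (inv_word w); rewrite inv_wordK. Qed.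

Fact pres_inv u v : pres_eq u v -> pres_eq (inv_word u) (inv_word v).
Proof.
move=> uv; apply: (@Pres_trans _ (inv_word u ++ (v ++ inv_word v))).
  rewrite -[X in pres_eq X _]cats0; apply: Pres_cat; first exact: Pres_refl.
  exact/Pres_sym/pres_mulV.
rewrite catA -[X in pres_eq _ X]cat0s.
apply: Pres_cat; last exact: Pres_refl.
apply: Pres_trans (pres_Vmul u); apply: Pres_cat; first exact: Pres_refl.
exact: Pres_sym.
Qed.

Let pmul (a b : presented) : presented := pcl (repr a ++ repr b).
Let pinv (a : presented) : presented := pcl (inv_word (repr a)).

Fact pcl_mulE u v : pmul (pcl u) (pcl v) = pcl (u ++ v).
Proof. by apply/pclP; apply: Pres_cat; apply/pclP; rewrite pcl_repr. Qed.

Fact pcl_invE u : pinv (pcl u) = pcl (inv_word u).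
Proof. by apply/pclP; apply: pres_inv; apply/pclP; rewrite pcl_repr. Qed.

Fact pmulA : associative pmul.
Proof.
move=> a b c; rewrite -(pcl_repr a) -(pcl_repr b) -(pcl_repr c).
by rewrite !pcl_mulE catA.
Qed.
Fact pmul1 : left_id (pcl [::]) pmul.
Proof. by move=> a; rewrite -(pcl_repr a) pcl_mulE. Qed.
Fact p1mul : right_id (pcl [::]) pmul.
Proof. by move=> a; rewrite -(pcl_repr a) pcl_mulE cats0. Qed.
Fact pmulV : left_inverse (pcl [::]) pinv pmul.
Proof.
move=> a; rewrite -(pcl_repr a) pcl_invE pcl_mulE.
by apply/pclP; exact: pres_Vmul.
Qed.
Fact pVmul : right_inverse (pcl [::]) pinv pmul.
Proof.
move=> a; rewrite -(pcl_repr a) pcl_invE pcl_mulE.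
by apply/pclP; exact: pres_mulV.
Qed.

HB.instance Definition _ :=
  isGroup.Build presented pmulA pmul1 p1mul pmulV pVmul.

Lemma pcl_cat u v : pcl (u ++ v) = pcl u * pcl v.
Proof. by rewrite -pcl_mulE. Qed.

End Presentation.

(** * First homology *)

Section Tensor.
Variables (A : groupType) (B : zmodType).

(* [tensor A B] is the tensor product over the integers of the abelian group A,
   written multiplicatively, with the additive group B; the result is written
   multiplicatively. *)
Inductive tensor_rel : word (A * B)%type -> word (A * B)%type -> Prop :=
| Tensor_l a a' b :
    tensor_rel [:: pos (a * a', b)] [:: pos (a, b); pos (a', b)]
| Tensor_r a b b' :
    tensor_rel [:: pos (a, (b + b')%R)] [:: pos (a, b); pos (a, b')]
| Tensor_comm t t' : tensor_rel [:: pos t; pos t'] [:: pos t'; pos t].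

Definition tensor := presented tensor_rel.

HB.instance Definition _ := Group.on tensor.

Definition tens (b : B) (a : A) : tensor := pcl tensor_rel [:: pos (a, b)].

Fact tensM b : {morph tens b : x y / x * y}.
Proof.
move=> x y; rewrite /tens -pcl_cat; apply/pclP; apply: Pres_relation.
exact: Tensor_l.
Qed.

HB.instance Definition _ b :=
  isMultiplicative.Build A tensor (tens b) (@tensM b).

End Tensor.

Section Abelianization.
Variable G : groupType.

Definition derived : subgroup G :=
  gen [set z | exists x y : G, z = [~ x, y]].

Fact derived_comm x y : derived [~ x, y].
Proof. by move=> K; apply; exists x, y. Qed.

Fact derived_normal : normal derived.
Proof.
move=> x y Dx; have -> : x ^ y = x * [~ x, y] by rewrite /commg mulVKg.
by apply: sg_mul => //; exact: derived_comm.
Qed.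

(* H_1(G, Z) *)
Definition H1Z := quotient (NormalSubgroup derived_normal).

HB.instance Definition _ := Group.on H1Z.

Fact H1Z_comm : forall a b : H1Z, commute a b.
Proof.
move=> a b; rewrite -(coset_repr a) -(coset_repr b) /commute -!cosetM.
apply/cosetP; rewrite invgM -mulgA -/(commg _ _).
exact: derived_comm.
Qed.

Definition h1z : G -> H1Z := coset _.

HB.instance Definition _ := Multiplicative.on h1z.

End Abelianization.

Section Torsion.
Variables (A : groupType) (cA : forall a b : A, commute a b).

Definition tors_set : set A := [set a | exists2 n, (0 < n)%N & a ^+ n = 1].

Fact tors_one : tors_set 1.
Proof. by exists 1%N. Qed.

Fact tors_div x y : tors_set x -> tors_set y -> tors_set (x / y).
Proof.
move=> [m m0 xm] [n n0 yn]; exists (m * n)%N; first by rewrite muln_gt0 m0.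
rewrite expgnFl; last exact: cA.
by rewrite expgnA xm expg1n mulnC expgnA yn expg1n divgg.
Qed.

Definition tors : subgroup A := Subgroup tors_one tors_div.

Fact tors_normal : normal tors.
Proof. by move=> x y Tx; rewrite /conjg (cA x y) mulKg. Qed.

Definition TFr := quotient (NormalSubgroup tors_normal).

HB.instance Definition _ := Group.on TFr.

Definition tfr : A -> TFr := coset _.

HB.instance Definition _ := Multiplicative.on tfr.

End Torsion.

(* H_1(G, Q) = H_1(G, Z) (x) Q *)
Definition H1Q (G : groupType) := tensor (H1Z G) rat.

Definition h1q (G : groupType) : G -> H1Q G :=
  tens (1 : rat)%R \o @h1z G.

HB.instance Definition _ (G : groupType) := Group.on (H1Q G).
HB.instance Definition _ (G : groupType) := Multiplicative.on (@h1q G).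

(* For p > 1, 'Z_p is Z/pZ. *)
Definition TFrH1p (p : nat) (G : groupType) :=
  tensor (TFr (@H1Z_comm G)) 'Z_p.

Definition tfrh1p (p : nat) (G : groupType) : G -> TFrH1p p G :=
  tens (1 : 'Z_p)%R \o @tfr _ (@H1Z_comm G) \o @h1z G.

HB.instance Definition _ p (G : groupType) := Group.on (TFrH1p p G).
HB.instance Definition _ p (G : groupType) := Multiplicative.on (@tfrh1p p G).

(** * RFRp groups *)

Definition elementary_abelian (p : nat) (Q : groupType) : Prop :=
  (forall a b : Q, commute a b) /\ (forall a : Q, a ^+ p = 1).

Definition rfrp_space (p : nat) (G : groupType) : Type := G.

Section RFRp.
Variables (p : nat) (G : groupType).

(* The subgroup L of G, intersected with K and viewed inside K. *)
Definition sg_in (K L : subgroup G) : subgroup (subg K) :=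
  sg_preim (val : subg K -> G) L.

(* The sequences are indexed from 0, so that F i stands for G_(i+1). *)
Definition rfrp_filtration (F : nat -> subgroup G) : Prop :=
  [/\ F 0%N = setT :> set G,
      forall i, F i.+1 `<=` F i,
      forall i, exists nF : normal (sg_in (F i) (F i.+1)),
        elementary_abelian p (quotient (NormalSubgroup nF)),
      \bigcap_i (F i : set G) = [set 1] &
      forall i, (ker (@h1q (subg (F i))) : set _) `<=` sg_in (F i) (F i.+1)].

Definition RFRp : Prop :=
  finitely_generated G /\ exists F, rfrp_filtration F.

Definition std_step (K : subgroup G) : subgroup G :=
  sg_im (val : subg K -> G) (ker (@tfrh1p p (subg K))).

Definition std_filtration (i : nat) : subgroup G :=
  iter i std_step (sg_full G).

Local Notation space := (rfrp_space p G).

HB.instance Definition _ := Choice.on space.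
HB.instance Definition _ := isPointed.Build space (1 : G).

Definition std_coset (c : space * nat) : set space :=
  [set x : G | std_filtration c.2 ((c.1 : G)^-1 * x)].

Lemma std_step_sub K : std_step K `<=` K.
Proof. by move=> _ [x _ <-]; apply/set_mem; exact: valP. Qed.

Lemma std_mono i j : (i <= j)%N -> std_filtration j `<=` std_filtration i.
Proof.
move=> /subnK <-; elim: (j - i)%N => // k IHk.
by apply: subset_trans IHk; exact: std_step_sub.
Qed.

Fact std_coset_cover : \bigcup_(c in setT) std_coset c = setT.
Proof. by rewrite -subTset => x _; exists (x, 0%N). Qed.

Fact std_coset_join c d (t : space) : setT c -> setT d ->
  std_coset c t -> std_coset d t ->
  exists e, [/\ setT e, std_coset e t &
                std_coset e `<=` std_coset c `&` std_coset d].
Proof.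
move: c d => [x i] [y j] _ _ /= tx ty; exists (t, maxn i j); split=> //.
  by rewrite /std_coset /= mulVg; exact: sg_one.
move=> z; rewrite /std_coset /= => tz; split=> /=.
  have := sg_mul tx (std_mono (leq_maxl i j) tz).
  by rewrite mulgA mulgK.
have := sg_mul ty (std_mono (leq_maxr i j) tz).
by rewrite mulgA mulgK.
Qed.

HB.instance Definition _ :=
  isBaseTopological.Build space std_coset_cover std_coset_join.

Definition rfrp_closed (H : set G) : Prop := closed (H : set space).

End RFRp.

(* The RFRp topology on G induces, along f : H -> G, the one on H. *)
Definition induces_rfrp (p : nat) (G H : groupType) (f : H -> G) : Prop :=
  forall j, exists i, f @^-1` std_filtration p G i `<=` std_filtration p H j.

(** * Graphs of groups *)

Section EdgePaths.
Variables (V E : finType) (src tgt : E -> V).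

(* (e, false) is e traversed from src e to tgt e, (e, true) its reverse. *)
Definition dart_from (d : E * bool) := if d.2 then tgt d.1 else src d.1.
Definition dart_to (d : E * bool) := if d.2 then src d.1 else tgt d.1.

Fixpoint edge_path (x y : V) (s : seq (E * bool)) : bool :=
  if s is d :: s' then (dart_from d == x) && edge_path (dart_to d) y s'
  else x == y.

Definition edges_in (T : {set E}) (s : seq (E * bool)) :=
  all (fun d => d.1 \in T) s.

Definition connected_by (T : {set E}) : Prop :=
  forall x y, exists2 s, edges_in T s & edge_path x y s.

Definition has_circuit (T : {set E}) : Prop :=
  exists x s, [/\ s != [::], edges_in T s, edge_path x x s
                & uniq [seq d.1 | d <- s]].

End EdgePaths.

Record graph_of_groups := GraphOfGroups {
  vert : finType;
  edge : finType;
  src : edge -> vert;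
  tgt : edge -> vert;
  graph_connected : connected_by src tgt [set: edge]%SET;
  vgrp : vert -> groupType;
  egrp : edge -> groupType;
  phi_src : forall e, {multiplicative egrp e -> vgrp (src e)};
  phi_tgt : forall e, {multiplicative egrp e -> vgrp (tgt e)} }.

(* Maximal trees are identified with their edge sets: as the graph is
   connected, they contain all vertices. *)
Definition maximal_tree (D : graph_of_groups) (T : {set edge D}) : Prop :=
  connected_by (@src D) (@tgt D) T /\ ~ has_circuit (@src D) (@tgt D) T.

Section FundamentalGroup.
Variables (D : graph_of_groups) (T : {set edge D}).

Definition fg_gen : choiceType := ({v : vert D & vgrp v} + edge D)%type.

Definition vgen (v : vert D) (g : vgrp v) : fg_gen := inl (Tagged (@vgrp D) g).
Definition tau (e : edge D) : fg_gen := inr e.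

Inductive fg_rel : word fg_gen -> word fg_gen -> Prop :=
| Fg_vertex v (g h : vgrp v) :
    fg_rel [:: pos (vgen g); pos (vgen h)] [:: pos (vgen (g * h))]
| Fg_edge e (c : egrp e) :
    fg_rel [:: pos (tau e); pos (vgen (phi_src e c)); neg (tau e)]
           [:: pos (vgen (phi_tgt e c))]
| Fg_tree e of e \in T : fg_rel [:: pos (tau e)] [::].

Definition fundamental_group := presented fg_rel.

HB.instance Definition _ := Group.on fundamental_group.

Definition vertex_map (v : vert D) (g : vgrp v) : fundamental_group :=
  pcl fg_rel [:: pos (vgen g)].

End FundamentalGroup.

(* Main.v *)
Require Import Defs.
From HB Require Import structures.
From mathcomp Require Import all_boot all_algebra ring.
From mathcomp Require Import boolp classical_sets topology_structure.

Set Implicit Arguments.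
Unset Strict Implicit.
Unset Printing Implicit Defensive.

Import GRing.Theory Num.Theory.

Local Open Scope classical_set_scope.
Local Open Scope group_scope.

(** Let G be the fundamental group, with standard filtration G_0 >= G_1 >=
    ... This filtration descends at least as fast as any other one that
    witnesses RFRp, so a finitely generated group is RFRp exactly when the
    terms of its standard filtration meet in the trivial group
    (RFRp_std_trivial and std_trivial_RFRp). It remains to separate each
    nontrivial x in G from 1.

    As the letters of the maximal tree are trivial, x is the value of a loop
    in the graph of groups: a product g_1 d_1 g_2 d_2 ... g_n d_n y where
    the d_k are darts forming a closed edge path and where the g_k and y are
    taken in the vertex groups met on the way. A backtrack d, g, d^-1 with g
    in the edge group can be removed, so the loop may be supposed reduced
    (gpath_reduce). If n = 0, then x lies in a vertex group, which is RFRp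
    and carries the induced topology (vert_std_trivial). The core of the
    proof, reduced_loop_sep, deals with n > 0.

    Think of the graph X_i whose vertices are the double cosets G_i z G_v
    and whose edges are the double cosets G_i z G_e: it is the quotient by
    G_i of the tree on which G acts. The loop traces a path in X_i, which
    closes up exactly when x g lies in G_i for some g in the final vertex
    group; when it is open, x is not in G_i. As edge groups are closed in
    the vertex groups, an element of a vertex group outside the edge group
    stays outside it modulo G_i for i large, so that the path in X_i does
    not backtrack (edge_sg_sep). By induction on n, the proper nonempty
    subloops are open paths in X_i for i large. If the path itself is
    closed, it crosses its first edge exactly once: a second crossing would
    produce a shorter closed subpath or a backtrack. Now the signed number
    of crossings of a fixed edge of X_i is a homomorphism from G_i to the
    integers. It takes the value 1 on every element of G_i that closes up
    the path, whereas G_(i+1) maps into p Z (std_step_hom). So the path is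
    open in X_(i+1).

    The crossing numbers are built from the presentation (crossing_cocycle):
    on the whole of G they form a crossed homomorphism with values in the
    functions on G, which becomes a homomorphism on G_i. The homological
    definition of the filtration enters through std_step_min, which
    describes one step without homology: it is the least subgroup that
    contains the commutators, the p-th powers and the torsion modulo
    commutators. *)

(** * Evaluating words in a presented group *)

(** The presented group acts by translations on the functions defined on it;
    a crossed homomorphism to the functions with values in A is a map c with
    c x (y z) = c x y c (x y) z. It is determined by its values wt x a on the
    generators a, and it extends any such values that respect the relations. *)
Section CrossedEvaluation.
Variables (X : choiceType) (R : word X -> word X -> Prop) (A : groupType).
Variable wt : presented R -> X -> A.

Fixpoint crossed_eval (x : presented R) (w : word X) : A :=
  if w is a :: w' then
    let y := x * pcl R [:: a] in
    (if a.2 then (wt y a.1)^-1 else wt x a.1) * crossed_eval y w'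
  else 1.

Definition crossed_hom (x y : presented R) : A := crossed_eval x (repr y).

Lemma crossed_eval_cat x u v :
  crossed_eval x (u ++ v) = crossed_eval x u * crossed_eval (x * pcl R u) v.
Proof.
elim: u x => [|a u IHu] x /=.
  by rewrite mul1g -[pcl R [::]]/(1 : presented R) mulg1.
by rewrite IHu -(cat1s a u) pcl_cat !mulgA.
Qed.

Hypothesis wtR : forall u v x, R u v -> crossed_eval x u = crossed_eval x v.

Lemma crossed_eval_pres_eq u v x :
  pres_eq R u v -> crossed_eval x u = crossed_eval x v.
Proof.
move=> uv; elim: uv x => {u v} [u v Ruv x|[a b] x|//|u v _ IH x||] //=.
- exact: wtR.
- rewrite mulg1 -mulgA -pcl_cat.
  have -> : pcl R ([:: (a, b)] ++ [:: inv_letter (a, b)]) = 1.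
    by apply/pclP; apply: Pres_cancel.
  by rewrite mulg1; case: b => /=; rewrite ?mulgV ?mulVg.
- by move=> u v w _ IH1 _ IH2 x; rewrite IH1.
- move=> u u' v v' /pclP uu' IHu _ IHv x.
  by rewrite !crossed_eval_cat uu' IHu IHv.
Qed.

Lemma crossed_homM x y z :
  crossed_hom x (y * z) = crossed_hom x y * crossed_hom (x * y) z.
Proof.
rewrite /crossed_hom -[in x * y](pcl_repr y) -crossed_eval_cat.
by apply/crossed_eval_pres_eq/pclP; rewrite pcl_cat !pcl_repr.
Qed.

Lemma crossed_hom_gen x a : crossed_hom x (pcl R [:: pos a]) = wt x a.
Proof.
rewrite /crossed_hom (@crossed_eval_pres_eq _ [:: pos a]) /= ?mulg1 //.
by apply/pclP; rewrite pcl_repr.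
Qed.

Lemma crossed_hom_stable n x y :
  (forall z a, wt (n * z) a = wt z a) ->
  crossed_hom (n * x) y = crossed_hom x y.
Proof.
move=> wt_n; rewrite /crossed_hom; elim: (repr y) x => //= a w IHw x.
by rewrite -mulgA IHw !wt_n.
Qed.

End CrossedEvaluation.

(** Weights that do not depend on the base point give homomorphisms. *)
Section Evaluation.
Variables (X : choiceType) (R : word X -> word X -> Prop) (A : groupType).
Variable f : X -> A.

Local Notation ev := (crossed_eval (R := R) (fun=> f)).

Hypothesis fR : forall u v, R u v -> ev 1 u = ev 1 v.

Lemma pres_hom_exists : exists g : presented R -> A,
    {morph g : x y / x * y} /\ forall a, g (pcl R [:: pos a]) = f a.
Proof.
have evx x u : ev x u = ev 1 u.
  by move: x 1; elim: u => //= a u IHu x y; congr (_ * _); exact: IHu.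
have evR u v x : R u v -> ev x u = ev x v by rewrite !(evx x); exact: fR.
exists (crossed_hom (fun=> f) 1); split=> [x y|a]; last exact: crossed_hom_gen.
by rewrite crossed_homM // /crossed_hom (evx (1 * x)).
Qed.

End Evaluation.

(** * Morphisms and cosets *)

Section MoreMorphisms.
Variables (G H : groupType) (f : {multiplicative G -> H}).

Lemma multX x n : f (x ^+ n) = f x ^+ n.
Proof. by elim: n => [|n IHn]; rewrite ?mult1 // !expgS gmulfM IHn. Qed.

Lemma multV x : f x^-1 = (f x)^-1.
Proof. by rewrite -[x^-1]mul1g multF mult1 mul1g. Qed.

Lemma multR x y : f [~ x, y] = [~ f x, f y].
Proof. by rewrite /commg /conjg !gmulfM !multV. Qed.

End MoreMorphisms.

Lemma coset_eq1 (G : groupType) (N : normal_subgroup G) x :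
  coset N x = 1 <-> N x.
Proof.
rewrite -[1 in X in X <-> _](mult1 (coset N)).
split=> [/esym/cosetP|Nx]; first by rewrite invg1 mul1g.
by apply/esym/cosetP; rewrite invg1 mul1g.
Qed.

(** * Tensor products with the rationals *)

Section IntegerPowers.
Variable A : groupType.

Definition zexpg (a : A) (n : int) : A :=
  match n with Posz k => a ^+ k | Negz k => a ^- k.+1 end.

Lemma zexpgB a m n : zexpg a (m%:Z - n%:Z)%R = a ^+ m / a ^+ n.
Proof.
have [le_nm|/ltnW/subnK mn] := leqP n m; first by rewrite subzn // /= expgnFr.
rewrite -[in LHS]mn -[in RHS]mn PoszD opprD addrCA subrr addr0.
rewrite expgnDr invgM mulVKg.
by case: (_ - _)%N => [|k]; [rewrite [RHS]invg1 | rewrite -NegzE].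
Qed.

Lemma zexpgD a m n : zexpg a (m + n)%R = zexpg a m * zexpg a n.
Proof.
have diff (z : int) : exists i j : nat, z = (i%:Z - j%:Z)%R.
  case: z => k; first by exists k, 0%N; rewrite subr0.
  by exists 0%N, k.+1; rewrite NegzE sub0r.
have [[i [j ->]] [k [l ->]]] := (diff m, diff n).
rewrite addrACA -opprD -!PoszD !zexpgB [(j + l)%N]addnC !expgnDr invgM.
have ckj : commute (a ^+ k) (a ^- j).
  by apply/commuteV/commuteX2/commute_refl.
by rewrite -!mulgA; congr (_ * _); rewrite !mulgA ckj.
Qed.

Lemma zexpgMl (cA : forall a b : A, commute a b) a b n :
  zexpg (a * b) n = zexpg a n * zexpg b n.
Proof.
have abX k : (a * b) ^+ k = a ^+ k * b ^+ k by apply/expgMn/cA.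
by case: n => k; rewrite /= abX // invgM cA.
Qed.

End IntegerPowers.

Lemma fact_clears_denominators (q : rat) (n : nat) :
  (`|denq q| <= n)%N -> exists z : int, (n`!%:R * q = z%:~R)%R.
Proof.
move=> le_qn; have /dvdnP[k ->] : (`|denq q| %| n`!)%N.
  by rewrite dvdn_fact // absz_gt0 denq_eq0 le_qn.
exists (k%:Z * numq q)%R; rewrite natrM -mulrA intrM; congr (_ * _)%R.
rewrite -[X in (_ * X)%R]divq_num_den mulrCA.
rewrite -[(`|denq q|%:R)%R]/((`|denq q|%N : int)%:~R)%R.
by rewrite absz_denq divff ?mulr1 // intr_eq0 denq_eq0.
Qed.

Lemma tens0 (A : groupType) (B : zmodType) (a : A) : tens (0 : B)%R a = 1.
Proof.
apply: (mulgI (tens (0 : B)%R a)); rewrite mulg1 /tens -pcl_cat.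
have := Pres_relation (@Tensor_r A B a 0%R 0%R); rewrite addr0.
by move=> /Pres_sym/pclP.
Qed.

Lemma tensXr (A : groupType) (B : zmodType) (a : A) (b : B) n :
  tens (b *+ n)%R a = tens b a ^+ n.
Proof.
elim: n => [|n IHn]; first exact: tens0.
rewrite mulrS expgS -IHn /tens -pcl_cat.
exact/pclP/Pres_relation/Tensor_r.
Qed.

Section RationalTensor.
Variables (A : groupType) (cA : forall a b : A, commute a b).

(* Instead of localizing A, send the tensor of a and q to the power n! q of a:
   any given word has finitely many denominators, all of which divide n! for n
   large, and from there on the relations are respected. *)
Let wt n (t : A * rat) : A := zexpg t.1 (numq (n`!%:R * t.2)%R).
Let ev n := crossed_eval (R := @tensor_rel A rat) (fun=> wt n).

Let ev_indep n x y u : ev n x u = ev n y u.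
Proof. by elim: u x y => //= a u IHu x y; congr (_ * _); exact: IHu. Qed.

Let ev_cat n u v : ev n 1 (u ++ v) = ev n 1 u * ev n 1 v.
Proof. by rewrite /ev crossed_eval_cat; congr (_ * _); exact: ev_indep. Qed.

Let ev_pres_eq u v : pres_eq (@tensor_rel A rat) u v ->
  exists N, forall n, (N <= n)%N -> ev n 1 u = ev n 1 v.
Proof.
elim=> {u v}.
- move=> _ _ [a a' b|a b b'|t t'].
  + by exists 0%N => n _; rewrite /ev /= !mulg1 /wt zexpgMl.
  + exists (maxn `|denq b| `|denq b'|) => n; rewrite geq_max => /andP[].
    move=> /fact_clears_denominators[z zE] /fact_clears_denominators[z' z'E].
    rewrite /ev /= !mulg1 /wt /= mulrDr zE z'E -intrD !numq_int.
    exact: zexpgD.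
  + by exists 0%N => n _; rewrite /ev /= !mulg1; exact: cA.
- move=> [t b]; exists 0%N => n _; rewrite /ev /= mulg1.
  by case: b; rewrite ?mulgV ?mulVg.
- by move=> u; exists 0%N.
- by move=> u v _ [N IH]; exists N => n /IH.
- move=> u v w _ [N IH] _ [N' IH']; exists (maxn N N') => n.
  by rewrite geq_max => /andP[/IH -> /IH'].
- move=> u u' v v' _ [N IH] _ [N' IH']; exists (maxn N N') => n.
  by rewrite geq_max !ev_cat => /andP[/IH -> /IH' ->].
Qed.

(** The word of one letter (a, 1) evaluates to a to the power n!. *)
Lemma tens_rat_torsion (a : A) : tens (1 : rat)%R a = 1 -> tors_set a.
Proof.
move=> /pclP /ev_pres_eq[N /(_ N (leqnn N))]; rewrite /ev /= mulg1 /wt /=.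
rewrite mulr1 -[(N`!%:R)%R]/((N`! : int)%:~R)%R numq_int /= => aN.
by exists N`!; rewrite ?fact_gt0.
Qed.

(** Conversely torsion dies, since 1 is divisible in the rationals. *)
Lemma torsion_tens_rat (a : A) : tors_set a -> tens (1 : rat)%R a = 1.
Proof.
case=> n n_gt0 an.
have -> : (1 : rat)%R = (n%:R^-1 *+ n)%R.
  by rewrite -[RHS]mulr_natr mulVf // pnatr_eq0 -lt0n.
by rewrite tensXr -multX an mult1.
Qed.

End RationalTensor.

(** * One step of the standard filtration *)

Section Step.
Variable (G : groupType).
Implicit Types K L M : subgroup G.

(** The derived subgroup of K, seen in G: it spares the passage to the subtype
    of elements of K when several subgroups are compared. *)
Definition derived_in K : subgroup G :=
  gen [set z | exists x y, [/\ K x, K y & z = [~ x, y]]].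

Definition in_subg K x (Kx : K x) : subg K := exist _ x (mem_set Kx).

Definition incl K (x : subg K) : G := sval x.

Lemma inclP K (x : subg K) : K (incl x).
Proof. exact/set_mem/(valP x). Qed.

Lemma incl_inj K : injective (@incl K).
Proof. exact: val_inj. Qed.

Lemma inclR K (x y : subg K) : incl [~ x, y] = [~ incl x, incl y].
Proof. exact: (multR (val : subg K -> G)). Qed.

Lemma inclX K (x : subg K) n : incl (x ^+ n) = incl x ^+ n.
Proof. exact: (multX (val : subg K -> G)). Qed.

Lemma sg_exp K x n : K x -> K (x ^+ n).
Proof.
move=> Kx; elim: n => [|n IHn]; first exact: sg_one.
by rewrite expgS; exact: sg_mul.
Qed.

Lemma sg_comm K x y : K x -> K y -> K [~ x, y].
Proof.
move=> Kx Ky; rewrite /commg /conjg.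
by do !apply: sg_mul => //; exact: sg_inv.
Qed.

Lemma derived_in_sub K L : K `<=` L -> derived_in K `<=` derived_in L.
Proof.
move=> KL z Dz M LM; apply: Dz => _ [x [y [Kx Ky ->]]].
by apply: LM; exists x, y; split=> //; exact: KL.
Qed.

Lemma derived_inE K (x : subg K) : derived_in K (incl x) <-> derived (subg K) x.
Proof.
split=> Dx.
  have /Dx[y Dy /incl_inj <- //] :
      [set z | exists x y, [/\ K x, K y & z = [~ x, y]]]
      `<=` sg_im (val : subg K -> G) (derived (subg K)).
  move=> _ [a [b [Ka Kb ->]]]; exists [~ in_subg Ka, in_subg Kb].
    exact: derived_comm.
  exact: inclR.
have /Dx // : [set z : subg K | exists x y, z = [~ x, y]] `<=`
    sg_preim (val : subg K -> G) (derived_in K).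
move=> _ [a [b ->]]; suff : derived_in K (incl [~ a, b]) by [].
rewrite inclR => M; apply.
by exists (incl a), (incl b); split=> //; exact: inclP.
Qed.

Lemma h1z_eq1 (H : groupType) (x : H) : h1z x = 1 <-> derived H x.
Proof. exact: coset_eq1. Qed.

Lemma h1z_torsion (H : groupType) (x : H) :
  tors_set (h1z x) <-> exists2 n, (0 < n)%N & derived H (x ^+ n).
Proof.
have E n : h1z x ^+ n = h1z (x ^+ n) by rewrite (multX (@h1z H)).
split=> -[n n0 xn]; exists n => //; first by apply/h1z_eq1; rewrite -E.
by rewrite E; exact/h1z_eq1.
Qed.

Lemma ker_h1q (H : groupType) (x : H) :
  h1q x = 1 <-> exists2 n, (0 < n)%N & derived H (x ^+ n).
Proof.
rewrite -h1z_torsion; split; first exact/tens_rat_torsion/H1Z_comm.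
exact: torsion_tens_rat.
Qed.

Variables (p : nat) (p_gt1 : (1 < p)%N).

Section TensorZp.
Variable A : groupType.
Local Notation cls := (pcl (@tensor_rel A 'Z_p)).

Let cls_letter l :
  cls [:: l] = if l.2 then (cls [:: pos l.1])^-1 else cls [:: pos l.1].
Proof.
case: l => t [] //=; apply: (mulgI (cls [:: pos t])); rewrite mulgV -pcl_cat.
exact/pclP/(Pres_cancel _ (pos t)).
Qed.

Lemma tens_Zp_comm (a b : tensor A 'Z_p) : commute a b.
Proof.
rewrite -(pcl_repr a) -(pcl_repr b).
have commV (H : groupType) (x y : H) : commute x y -> commute x^-1 y.
  by move=> xy; apply/commute_sym/commuteV/commute_sym.
have comm1 l m : commute (cls [:: l]) (cls [:: m]).
  have c t t' : commute (cls [:: pos t]) (cls [:: pos t']).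
    rewrite /commute -!pcl_cat; apply/pclP/Pres_relation; exact: Tensor_comm.
  rewrite (cls_letter l) (cls_letter m); case: l.2; case: m.2.
  - exact/commV/commuteV.
  - exact/commV.
  - exact/commuteV.
  - exact: c.
have comm2 l v : commute (cls [:: l]) (cls v).
  elim: v => [|m v IHv]; first exact: commute1.
  by rewrite -(cat1s m v) pcl_cat; apply: commuteM.
elim: (repr a) => [|l u IHu]; first exact/commute_sym/commute1.
rewrite -(cat1s l u) pcl_cat; apply/commute_sym/commuteM; apply: commute_sym.
  exact: comm2.
exact: IHu.
Qed.

Lemma tens_Zp_exp (a : tensor A 'Z_p) : a ^+ p = 1.
Proof.
rewrite -(pcl_repr a); elim: (repr a) => [|l u IHu]; first exact: expg1n.
rewrite -(cat1s l u) pcl_cat expgMn; last exact: tens_Zp_comm.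
rewrite [X in _ * X]IHu mulg1.
have tp t : cls [:: pos t] ^+ p = 1.
  case: t => x b; rewrite -[LHS]/(tens b x ^+ p) -tensXr -mulr_natr.
  by rewrite pchar_Zp // mulr0 tens0.
by rewrite cls_letter; case: l.2; rewrite ?expVgn tp ?invg1.
Qed.

End TensorZp.

Lemma tfrh1p_comm (H : groupType) (x y : H) : tfrh1p p [~ x, y] = 1.
Proof. by rewrite multR; apply/eqP/commgP/tens_Zp_comm. Qed.

Lemma tfrh1p_exp (H : groupType) (x : H) : tfrh1p p (x ^+ p) = 1.
Proof. by rewrite multX; exact: tens_Zp_exp. Qed.

Lemma tfr_eq1 (H : groupType) (x : H) :
  tfr (@H1Z_comm H) (h1z x) = 1 <-> tors_set (h1z x).
Proof. exact: coset_eq1. Qed.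

Lemma tfrh1p_tors (H : groupType) (x : H) n :
  (0 < n)%N -> derived H (x ^+ n) -> tfrh1p p x = 1.
Proof.
move=> n0 Dxn; rewrite /tfrh1p /=.
have /tfr_eq1 -> : tors_set (h1z x) by apply/h1z_torsion; exists n.
exact: (mult1 (tens _)).
Qed.

(** The map to TFr H_1 tensored with Z/p is the universal homomorphism to an
    elementary abelian p-group that kills the torsion of H_1. Only the inclusion
    of kernels is stated: the factorization sends the tensor of a and k to the
    k-th power of the image of a lift of a. *)
Lemma tfrh1p_universal (H Q : groupType) (f : {multiplicative H -> Q}) :
  elementary_abelian p Q ->
  (forall x n, (0 < n)%N -> derived H (x ^+ n) -> f x = 1) ->
  forall x, tfrh1p p x = 1 -> f x = 1.
Proof.
move=> [cQ expQ] f_tors.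
pose F (a : TFr (@H1Z_comm H)) : Q := f (repr (repr a : H1Z H)).
have FE x : F (tfr (@H1Z_comm H) (h1z x)) = f x.
  rewrite /F; set y := repr _.
  apply: divg1_eq; rewrite -multF.
  have /tfr_eq1/h1z_torsion[n n0] : tfr (@H1Z_comm H) (h1z (y / x)) = 1.
    have yx : tfr (@H1Z_comm H) (h1z y) = tfr (@H1Z_comm H) (h1z x).
      by rewrite /h1z coset_repr [LHS]coset_repr.
    rewrite (multF (@h1z H)) (multF (tfr (@H1Z_comm H))).
    have div1 (K : groupType) (a b : K) : a = b -> a / b = 1.
      by move=> ->; exact: mulgV.
    exact: div1 yx.
  exact: f_tors.
have FM a b : F (a * b) = F a * F b.
  have lift c : exists x, c = tfr (@H1Z_comm H) (h1z x).
    exists (repr (repr c : H1Z H)); rewrite /h1z coset_repr.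
    by rewrite [RHS]coset_repr.
  have [[x ->] [y ->]] := (lift a, lift b).
  have E : tfr (@H1Z_comm H) (h1z x) * tfr (@H1Z_comm H) (h1z y) =
      tfr (@H1Z_comm H) (h1z (x * y)).
    have -> : h1z (x * y) = h1z x * h1z y by exact: gmulfM.
    by apply/esym; exact: gmulfM.
  rewrite [X in F X]E !FE; exact: gmulfM.
have expQm a m n : m = n %[mod p] -> a ^+ m = a ^+ n :> Q.
  move=> mn; rewrite (divn_eq m p) (divn_eq n p) mn.
  by rewrite !expgnDr ![(_ %/ _ * p)%N]mulnC !expgnA !expQ !expg1n.
have [u v uv|g [gM gE]] := @pres_hom_exists _
    (@tensor_rel (TFr (@H1Z_comm H)) 'Z_p) Q (fun t => F t.1 ^+ (t.2 : nat)).
  case: {u v} uv => [a a' b|a b b'|t t'] /=; rewrite !mulg1.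
  - by rewrite FM expgMn.
  - rewrite -expgnDr; apply: expQm.
    have modE k : (k %% (Zp_trunc p).+2 = k %% p)%N by rewrite Zp_cast.
    exact: (etrans (congr1 (modn^~ p) (modE (b + b')%N)) (modn_mod _ _)).
  - exact: cQ.
move=> x.
rewrite -[tfrh1p p x]/(pcl _ [:: pos (tfr (@H1Z_comm H) (h1z x), 1%R)]).
move=> tx; have := gE (tfr (@H1Z_comm H) (h1z x), 1%R); rewrite tx /= FE.
have -> : g 1 = 1 by apply: (mulgI (g 1)); rewrite -gM !mulg1.
by rewrite /= modn_small // => <-.
Qed.

Lemma std_step_comm K x y : K x -> K y -> std_step p K [~ x, y].
Proof.
move=> Kx Ky; exists [~ in_subg Kx, in_subg Ky]; last exact: inclR.
exact: tfrh1p_comm.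
Qed.

Lemma std_step_exp K x : K x -> std_step p K (x ^+ p).
Proof.
move=> Kx; exists (in_subg Kx ^+ p); last exact: inclX.
exact: tfrh1p_exp.
Qed.

Lemma std_step_tors K x n : (0 < n)%N -> K x -> derived_in K (x ^+ n) ->
  std_step p K x.
Proof.
move=> n0 Kx Dx; exists (in_subg Kx) => //; apply: (tfrh1p_tors n0).
by apply/derived_inE; rewrite inclX.
Qed.

Lemma normal_of_comm K M : (forall x y, K x -> K y -> M [~ x, y]) ->
  normal (sg_in K M).
Proof.
move=> MR x y Mx; suff : M (incl (x ^ y)) by [].
have -> : x ^ y = x * [~ x, y] by rewrite /commg mulVKg.
rewrite -[incl _]/(incl x * incl [~ x, y]) inclR; apply: sg_mul => //.
by apply: MR; exact: inclP.
Qed.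

(** So one step of the standard filtration yields the least subgroup with the
    three properties above: modulo M, the group K is elementary abelian and its
    map to the quotient kills the torsion of H_1. *)
Lemma std_step_min K M :
  (forall x y, K x -> K y -> M [~ x, y]) ->
  (forall x, K x -> M (x ^+ p)) ->
  (forall x n, (0 < n)%N -> K x -> derived_in K (x ^+ n) -> M x) ->
  std_step p K `<=` M.
Proof.
move=> MR MX Mtors _ [x xker <-].
pose Q := quotient (NormalSubgroup (normal_of_comm MR)).
have cosetE z : coset (NormalSubgroup (normal_of_comm MR)) z = 1 <-> M (incl z).
  exact: coset_eq1.
have f_ker := @tfrh1p_universal (subg K) Q (coset _).
apply/cosetE; apply: f_ker => //; last first.
  move=> z n n0 Dz; apply/cosetE/(Mtors _ n) => //; first exact: inclP.
  by rewrite -inclX; apply/derived_inE.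
split=> [a b|a]; rewrite -(coset_repr a); move: (repr a) => a'.
  rewrite -(coset_repr b); move: (repr b) => b'; apply/commgP/eqP.
  rewrite -multR.
  by apply/cosetE; rewrite inclR; apply: (MR _ _ (inclP a') (inclP b')).
by rewrite -multX; apply/cosetE; rewrite inclX; exact/MX/inclP.
Qed.

End Step.

(** * The standard filtration *)

Section StandardFiltration.
Variables (p : nat) (p_gt1 : (1 < p)%N) (G : groupType).
Implicit Types K L M : subgroup G.

Local Notation std := (std_filtration p G).

(** A homomorphism from K to the integers kills commutators and, the integers
    being torsion-free, torsion modulo commutators; it sends p-th powers to
    multiples of p. *)
Lemma std_step_hom K (f : G -> int) :
  (forall x y, K x -> K y -> f (x * y) = (f x + f y)%R) ->
  forall x, std_step p K x -> (p %| f x)%Z.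
Proof.
move=> fM.
have f1 : f 1 = 0%R.
  by apply: (@addrI _ (f 1)); rewrite -fM ?mulg1 ?addr0 //; exact: sg_one.
have fV x : K x -> f x^-1 = (- f x)%R.
  move=> Kx; apply: (@addrI _ (f x)); rewrite -fM ?mulgV ?subrr //.
  exact: sg_inv.
have fX x n : K x -> f (x ^+ n) = (f x *+ n)%R.
  move=> Kx; elim: n => [|n IHn]; first by rewrite f1.
  by rewrite expgS fM ?IHn ?mulrS //; exact: sg_exp.
have fR x y : K x -> K y -> f [~ x, y] = 0%R.
  move=> Kx Ky; have [Vx Vy] := (sg_inv Kx, sg_inv Ky).
  rewrite /commg /conjg !fM ?fV //; try by do ?apply: sg_mul.
  by rewrite [(f x + _)%R]addrC addKr addNr.
have ker_one : [set x | K x /\ f x = 0%R] 1 by split=> //; exact: sg_one.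
have ker_div x y : [set x | K x /\ f x = 0%R] x ->
    [set x | K x /\ f x = 0%R] y -> [set x | K x /\ f x = 0%R] (x / y).
  move=> [Kx fx] [Ky fy]; split; first exact: sg_div.
  by rewrite fM ?fV ?fx ?fy ?oppr0 ?addr0 //; exact: sg_inv.
have derf x : derived_in K x -> f x = 0%R.
  move=> /(_ (Subgroup ker_one ker_div))[] // _ [a [b [Ka Kb ->]]].
  by split; [exact: sg_comm | exact: fR].
pose S := [set x | K x /\ (p %| f x)%Z].
have S_one : S 1 by split; [exact: sg_one | rewrite f1 dvdz0].
have S_div x y : S x -> S y -> S (x / y).
  move=> [Kx fx] [Ky fy]; split; first exact: sg_div.
  by rewrite fM ?fV //; [exact: rpredB | exact: sg_inv].
suff : std_step p K `<=` Subgroup S_one S_div by move=> KS x /KS[].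
apply: std_step_min => //.
- by move=> x y Kx Ky; split; [exact: sg_comm | rewrite fR // dvdz0].
- move=> x Kx; split; first exact: sg_exp.
  by rewrite fX // -mulr_natr natz dvdz_mull.
- move=> x n n0 Kx /derf; rewrite fX // => /eqP.
  rewrite mulrn_eq0 -leqn0 leqNgt n0 /= => /eqP fx.
  by split; rewrite ?fx ?dvdz0.
Qed.

(** The least subgroup with properties stable under conjugation is normal. *)
Lemma std_step_normal K : normal K -> normal (std_step p K).
Proof.
move=> nK x g; pose conj_g := [set z | std_step p K (z ^ g)].
have one_g : conj_g 1 by rewrite /conj_g /mkset conj1g; exact: sg_one.
have div_g y z : conj_g y -> conj_g z -> conj_g (y / z).
  by rewrite /conj_g /mkset conjMg conjVg; exact: sg_div.
have derJ z : derived_in K z -> derived_in K (z ^ g).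
  move=> Dz L KL; pose S := [set z | L (z ^ g)].
  have S1 : S 1 by rewrite /S /mkset conj1g; exact: sg_one.
  have SF y t : S y -> S t -> S (y / t).
    by rewrite /S /mkset conjMg conjVg; exact: sg_div.
  apply: (Dz (Subgroup S1 SF)) => _ [a [b [Ka Kb ->]]].
  rewrite -[sg_set _ _]/(S _) /S /mkset conjRg; apply: KL.
  by exists (a ^ g), (b ^ g); split=> //; exact: nK.
suff : std_step p K `<=` Subgroup one_g div_g by apply.
apply: std_step_min => //.
- move=> y z Ky Kz; rewrite -[sg_set _ _]/(std_step p K _) conjRg.
  by apply: std_step_comm => //; exact: nK.
- move=> y Ky; rewrite -[sg_set _ _]/(std_step p K _) conjXg.
  by apply: std_step_exp => //; exact: nK.
- move=> y n n0 Ky Dy; rewrite -[sg_set _ _]/(std_step p K _).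
  apply: (std_step_tors p n0); first exact: nK.
  by rewrite -conjXg; exact: derJ.
Qed.

Lemma std_normal i : normal (std i).
Proof. by elim: i => [|i IHi] //; exact: std_step_normal. Qed.

(** The standard filtration descends at least as fast as any other: whatever is
    torsion in H_1 of std i is torsion in H_1 of F i, hence dies rationally and
    lies in F i.+1. *)
Lemma std_sub_filtration (F : nat -> subgroup G) i :
  rfrp_filtration p F -> std i `<=` F i.
Proof.
move=> [F0 _ Fel _ Fker]; elim: i => [|i IHi]; first by rewrite F0.
have [nF [cF eF]] := Fel i.
have cosetE z : coset (NormalSubgroup nF) z = 1 <-> F i.+1 (incl z).
  exact: coset_eq1.
apply: std_step_min => //.
- move=> x y /IHi Fx /IHi Fy.
  suff : F i.+1 (incl [~ in_subg Fx, in_subg Fy]) by rewrite inclR.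
  by apply/cosetE; rewrite multR; apply/eqP/commgP/cF.
- move=> x /IHi Fx; suff : F i.+1 (incl (in_subg Fx ^+ p)) by rewrite inclX.
  by apply/cosetE; rewrite multX; exact: eF.
- move=> x n n0 /IHi Fx /(derived_in_sub IHi) Dx.
  apply: (Fker i (in_subg Fx)); apply/ker_h1q; exists n => //.
  by apply/derived_inE; rewrite inclX.
Qed.

Lemma RFRp_std_trivial x : RFRp p G -> (forall i, std i x) -> x = 1.
Proof.
move=> [_ [F FF]] sx; have [_ _ _ capF _] := FF.
by rewrite -[x = 1]/([set 1] x) -capF => i _; exact: std_sub_filtration (sx i).
Qed.

Lemma std_trivial_RFRp : finitely_generated G ->
  (forall x, (forall i, std i x) -> x = 1) -> RFRp p G.
Proof.
move=> fgG std1; split=> //; exists std; split=> //.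
- by move=> i; exact: std_step_sub.
- move=> i.
  have stdR x y : std i x -> std i y -> std i.+1 [~ x, y].
    exact: std_step_comm.
  exists (normal_of_comm stdR).
  have cosetE z : coset (NormalSubgroup (normal_of_comm stdR)) z = 1 <->
      std i.+1 (incl z) by exact: coset_eq1.
  split=> [a b|a]; rewrite -(coset_repr a); move: (repr a) => a'.
    rewrite -(coset_repr b); move: (repr b) => b'; apply/commgP/eqP.
    rewrite -multR; apply/cosetE; rewrite inclR.
    exact: (stdR _ _ (inclP a') (inclP b')).
  rewrite -multX; apply/cosetE; rewrite inclX.
  by apply: std_step_exp => //; exact: inclP.
- apply/seteqP; split=> [x sx|_ -> i _]; last exact: sg_one.
  by apply: std1 => i; exact: sx.
- move=> i x /ker_h1q[n n0 Dx].
  apply: (std_step_tors p n0); first exact: inclP.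
  by rewrite -inclX; apply/derived_inE.
Qed.

(** Basic open sets are left cosets, and two points of the same left coset
    differ by right translation. *)
Lemma rfrp_closed_sep (H : set G) g : rfrp_closed p H -> ~ H g ->
  exists i, forall h, H h -> ~ std i (h^-1 * g).
Proof.
move=> clH Hg; apply: contrapT => /forallNP sep; apply: Hg.
apply: clH => B; rewrite nbhsE => -[U [[D' _ <-] [c D'c cg]] UB].
have [h Hh hg] : exists2 h, H h & std c.2 (h^-1 * g).
  have /existsNP[h /not_implyP[Hh /contrapT ?]] := sep c.2.
  by exists h.
exists h; split=> //; apply: UB; exists c => //; rewrite /std_coset /=.
have := sg_div cg hg.
by rewrite invgM invgK mulgA mulgK.
Qed.

End StandardFiltration.

(** * The two sides of an edge of a tree *)

Section EdgePathTheory.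
Variables (V E : finType) (src tgt : E -> V).

Definition rev_dart (d : E * bool) := (d.1, ~~ d.2).

Lemma rev_dartK : involutive rev_dart.
Proof. by case=> e b; rewrite /rev_dart /= negbK. Qed.

Lemma dart_from_rev d : dart_from src tgt (rev_dart d) = dart_to src tgt d.
Proof. by case: d => e []. Qed.

Lemma dart_to_rev d : dart_to src tgt (rev_dart d) = dart_from src tgt d.
Proof. by case: d => e []. Qed.

Lemma edge_path_cat_cons x y s1 d s2 :
  edge_path src tgt x y (s1 ++ d :: s2) =
  edge_path src tgt x (dart_from src tgt d) s1 &&
  edge_path src tgt (dart_to src tgt d) y s2.
Proof.
elim: s1 x => [|d1 s1 IHs1] x /=; first by rewrite eq_sym.
by rewrite IHs1 andbA.
Qed.

(** If a later dart d' runs through the edge of the first dart d, the path can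
    be shortened: start at d' if both have the same direction, and right after
    d' if the directions are opposite. *)
Lemma edge_path_uniq (T : {set E}) x y s :
  edges_in T s -> edge_path src tgt x y s ->
  exists s', [/\ edges_in T s', edge_path src tgt x y s'
               & uniq [seq d.1 | d <- s']].
Proof.
elim: s x => [|d s IHs] x /=; first by move=> _ xy; exists [::].
case/andP=> dT /IHs{}IHs /andP[/eqP <-] /IHs[s' [s'T ps' us']].
have [/mapP[d' d's' dd']|ds'] := boolP (d.1 \in map fst s'); last first.
  by exists (d :: s'); split; rewrite /= ?dT ?eqxx ?ds'.
case/splitPr: {s'} d's' s'T ps' us' => s1 s2.
rewrite /edges_in all_cat map_cat cat_uniq edge_path_cat_cons /=.
move=> /and3P[_ d'T s2T] /andP[_ ps2] /and4P[_ _ d's2 us2].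
have [b|b] := eqVneq d'.2 d.2.
  have dE : d = d'.
    by rewrite [d]surjective_pairing [d']surjective_pairing dd' b.
  by exists (d' :: s2); split; rewrite /= ?dE ?d'T ?eqxx ?d's2.
exists s2; split=> //; move: ps2.
have -> : d' = rev_dart d.
  by rewrite [d']surjective_pairing /rev_dart dd'; case: d'.2 d.2 b => [] [].
by rewrite dart_to_rev.
Qed.

(** Removing an edge of a tree separates its endpoints: a path between them in
    the rest of the tree may be taken without repeated edges, and the removed
    edge would close it to a circuit. *)
Lemma tree_edge_sides (T : {set E}) e0 :
  ~ has_circuit src tgt T -> e0 \in T ->
  exists side : V -> bool,
    [/\ side (src e0), ~~ side (tgt e0)
      & forall e, e \in T -> e != e0 -> side (src e) = side (tgt e)].
Proof.
move=> acyclic e0T.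
pose side v := `[< exists2 s, edges_in (T :\ e0) s
                            & edge_path src tgt v (src e0) s >].
exists side; split=> [||e eT ee0].
- by apply/asboolP; exists [::]; rewrite //= eqxx.
- apply/asboolP => -[s sT /(edge_path_uniq sT)[{sT}s [sT ps us]]].
  apply: acyclic; exists (src e0), ((e0, false) :: s); split=> //=.
  + rewrite e0T; apply: sub_all sT => d.
    by rewrite in_setD1 => /andP[].
  + by rewrite eqxx.
  + rewrite us andbT; apply/mapP => -[d ds e0d].
    by have /allP/(_ d ds) := sT; rewrite in_setD1 -e0d eqxx.
- have eT' : e \in T :\ e0 by rewrite in_setD1 ee0.
  apply/asboolP/asboolP => -[s sT ps].
    by exists ((e, true) :: s); rewrite /= ?eT' ?eqxx.
  by exists ((e, false) :: s); rewrite /= ?eT' ?eqxx.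
Qed.

End EdgePathTheory.

Section FundamentalGroupTheory.
Variables (D : graph_of_groups) (T : {set edge D}).
Hypothesis T_tree : maximal_tree T.

Local Notation gp := (fundamental_group T).
Local Notation vm := (@vertex_map D T).
Local Notation dfrom := (dart_from (@src D) (@tgt D)).
Local Notation dto := (dart_to (@src D) (@tgt D)).

Definition stable_letter (e : edge D) : gp := pcl (fg_rel T) [:: pos (tau e)].
Local Notation tl := stable_letter.

Fact vertex_mapM v : {morph @vertex_map D T v : g h / g * h}.
Proof.
move=> g h; rewrite /vertex_map -pcl_cat; apply/esym/pclP/Pres_relation.
exact: Fg_vertex.
Qed.

HB.instance Definition _ v :=
  isMultiplicative.Build (vgrp v) gp (@vertex_map D T v) (@vertex_mapM v).

Lemma pcl_neg (x : fg_gen D) :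
  pcl (fg_rel T) [:: neg x] = (pcl (fg_rel T) [:: pos x])^-1.
Proof.
apply: (mulgI (pcl _ [:: pos x])); rewrite mulgV -pcl_cat.
exact/pclP/(Pres_cancel _ (pos x)).
Qed.

Lemma stable_letterJ e c :
  vm (phi_tgt e c) = tl e * vm (phi_src e c) / tl e.
Proof.
rewrite /vertex_map /stable_letter -pcl_neg -[X in _ = X * _]pcl_cat -pcl_cat.
apply/esym/pclP/Pres_relation.
exact: Fg_edge.
Qed.

Lemma stable_letter_tree e : e \in T -> tl e = 1.
Proof. by move=> eT; apply/pclP/Pres_relation/Fg_tree. Qed.

(** * Counting the crossings of an edge *)

(** When chi is the indicator function of a set of edges of type e0 in the tree
    on which G acts, the value cnt x y is the number of signed crossings of
    these edges on the way from the base point translated by x to the base point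
    translated by x y. A letter g of a vertex group G_v stands for the detour
    from the base point to v in the maximal tree, followed by the translate by g
    of the way back; sigma v counts the crossings of e0 on the way to v, up to a
    constant independent of v, which changes cnt by a coboundary only. So sigma
    may be taken 0 when e0 is not in the maximal tree, and otherwise 1 on the
    side of the source of e0 and 0 on the other side. In the latter case the
    crossing of e0 is cancelled by its two detours, as it must be because the
    letter of e0 is trivial. *)
Lemma crossing_cocycle (e0 : edge D) (chi : gp -> int) :
  (forall x c, chi (x * vm (phi_tgt e0 c)) = chi x) ->
  exists (sigma : vert D -> int) (cnt : gp -> gp -> int),
  [/\ forall x y z, cnt x (y * z) = (cnt x y + cnt (x * y)%g z)%R,
      forall x v g, cnt x (vm g) =
        (sigma v * chi x - sigma v * chi (x * @vertex_map D T v g)%g)%R,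
      forall x e, cnt x (tl e) =
        (sigma (tgt e) * chi x - sigma (src e) * chi (x * tl e)%g
         + (e == e0)%:R * chi x)%R &
      forall n, (forall x, chi (n * x) = chi x) ->
        forall x y, cnt (n * x) y = cnt x y].
Proof.
move=> chiE.
have [sigma sigmaT] : exists sigma : vert D -> int, forall e, e \in T ->
    sigma (src e) = (sigma (tgt e) + (e == e0)%:R)%R.
  have [e0T|e0T] := boolP (e0 \in T); last first.
    exists (fun=> 0%R) => e eT; have [ee0|_] := eqVneq e e0; last by [].
    by rewrite ee0 (negPf e0T) in eT.
  have [side [srcT /negPf tgtF sideE]] := tree_edge_sides (proj2 T_tree) e0T.
  exists (fun v => (side v)%:R)%R => e eT.
  have [->|/(sideE e eT) ->] := eqVneq e e0; last by rewrite addr0.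
  by rewrite srcT tgtF add0r.
pose wt (x : gp) (a : fg_gen D) : Algebra.to_multiplicative int := match a with
  | inl (existT v g) => (sigma v * chi x - sigma v * chi (x * vm g)%g)%R
  | inr e => (sigma (tgt e) * chi x - sigma (src e) * chi (x * tl e)%g
              + (e == e0)%:R * chi x)%R
  end.
have wtR u v x : fg_rel T u v -> crossed_eval wt x u = crossed_eval wt x v.
  pose Z := Algebra.to_multiplicative int.
  have addE (a b : Z) : a * b = (a + b :> int)%R by [].
  have oppE (a : Z) : a^-1 = (- a :> int)%R by [].
  case=> {u v} [v g h|e c|e eT] /=; rewrite !mulg1 ?addE ?oppE -?/(tl e).
  - rewrite -/(vm g) vertex_mapM mulgA; ring.
  - rewrite pcl_neg -/(tl e) -/(vm (phi_src e c)) mulgVK.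
    have -> : (x * tl e * vm (phi_src e c) / tl e = x * vm (phi_tgt e c))%g.
      by rewrite stable_letterJ !mulgA.
    have -> : ((e == e0)%:R * chi (x * vm (phi_tgt e c))%g =
               (e == e0)%:R * chi x)%R.
      have [ee0|_] := eqVneq e e0; last by rewrite !mul0r.
      by have := chiE; rewrite -ee0 => ->.
    by ring.
  - by rewrite stable_letter_tree // mulg1 sigmaT //; ring.
exists sigma, (crossed_hom wt); split.
- exact: (crossed_homM wtR).
- by move=> x v g; exact: (crossed_hom_gen wtR).
- by move=> x e; exact: (crossed_hom_gen wtR).
- move=> n chi_n x y.
  apply: (@crossed_hom_stable _ _ _ wt n x y) => z [[v g]|e] /=.
    by rewrite -mulgA !chi_n.
  by rewrite -mulgA !chi_n.
Qed.

(** In the relation tau phi_src(c) tau^-1 = phi_tgt(c), the letter tau stands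
    between the vertex groups of the target, on its left, and of the source:
    read from left to right, it leads from the target to the source. *)
Definition dart_elt (d : edge D * bool) : gp :=
  if d.2 then tl d.1 else (tl d.1)^-1.

Definition vert_sg v : subgroup gp := sg_im (@vertex_map D T v) (sg_full _).

(** The edge group of d, embedded at the vertex where d starts. *)
Definition edge_sg (d : edge D * bool) : subgroup gp :=
  if d.2
  then sg_im (@vertex_map D T (tgt d.1)) (sg_im (phi_tgt d.1) (sg_full _))
  else sg_im (@vertex_map D T (src d.1)) (sg_im (phi_src d.1) (sg_full _)).

Lemma dart_elt_rev d : dart_elt (rev_dart d) = (dart_elt d)^-1.
Proof. by case: d => e []; rewrite /dart_elt //= invgK. Qed.

Lemma edge_sg_vert d : edge_sg d `<=` vert_sg (dfrom d).
Proof. by case: d => e [] _ [g _ <-]; exists g. Qed.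

Lemma edge_sgJ d c : edge_sg d c ->
  edge_sg (rev_dart d) ((dart_elt d)^-1 * c * dart_elt d).
Proof.
case: d => e [] [_ [g _ <-] <-]; rewrite /dart_elt /=.
  exists (phi_src e g); first by exists g.
  by rewrite stable_letterJ !mulgA mulVg mul1g mulgVK.
exists (phi_tgt e g); first by exists g.
by rewrite stable_letterJ invgK.
Qed.

Definition indic (S : set gp) (x : gp) : int := (`[< S x >] : bool)%:R%R.

Lemma indic1 (S : set gp) x : S x -> indic S x = 1%R.
Proof. by move=> Sx; rewrite /indic asboolT. Qed.

Lemma indic0 (S : set gp) x : ~ S x -> indic S x = 0%R.
Proof. by move=> Sx; rewrite /indic asboolF. Qed.

Lemma cocycle1 (cnt : gp -> gp -> int) x :
  (forall x y z, cnt x (y * z) = (cnt x y + cnt (x * y)%g z)%R) ->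
  cnt x 1 = 0%R.
Proof.
move=> cntM; apply: (@addrI _ (cnt x 1)).
by rewrite addr0 -[in RHS](mulg1 1) cntM mulg1.
Qed.

(** The same count, oriented by a dart. A translate of the dart a is recorded by
    the position x where it starts: the dart a read at x crosses it positively,
    and the reverse dart read at x crosses the translate that starts where the
    reverse dart ends. *)
Lemma dart_crossing_cocycle (a : edge D * bool) (S : set gp) :
  (forall x c, edge_sg a c -> S (x * c) <-> S x) ->
  exists (beta : vert D -> gp -> int) (cnt : gp -> gp -> int),
  [/\ forall x y z, cnt x (y * z) = (cnt x y + cnt (x * y)%g z)%R,
      forall x v g, vert_sg v g -> cnt x g = (beta v x - beta v (x * g)%g)%R,
      forall x d, cnt x (dart_elt d) =
        (beta (dfrom d) x - beta (dto d) (x * dart_elt d)%g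
         + (d == a)%:R * indic S x
         - (d == rev_dart a)%:R * indic S (x * dart_elt d)%g)%R &
      forall n, (forall x, S (n * x) <-> S x) -> forall x,
        (forall y, cnt (n * x) y = cnt x y) /\
        (forall v, beta v (n * x) = beta v x)].
Proof.
move=> SE; have indE x y : (S x <-> S y) -> indic S x = indic S y.
  by move=> /propext xy; rewrite /indic xy.
(* If a runs along its letter, S is already a set of positions for the target
   end of the edge; otherwise it is translated there, and the sign changes. *)
pose chi (x : gp) : int :=
  if a.2 then indic S x else (- indic S (x * tl a.1)%g)%R.
have chiE x c : chi (x * vm (phi_tgt a.1 c)) = chi x.
  rewrite /chi; case: a c SE {chi} => e [] c SE /=.
    by apply/indE/SE; exists (phi_tgt e c); first by exists c.
  rewrite stable_letterJ -mulgA mulgVK mulgA; congr (- _)%R.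
  by apply/indE/SE; exists (phi_src e c); first by exists c.
have [sigma [cnt [cntM cntV cntE cntS]]] := crossing_cocycle chiE.
exists (fun v x => sigma v * chi x)%R, cnt; split=> //.
- by move=> x v _ [g _ <-]; exact: cntV.
- have cnt_inv x y : cnt x y^-1 = (- cnt (x * y^-1)%g y)%R.
    by apply/eqP; rewrite -addr_eq0 -cntM mulVg cocycle1.
  move=> x [e b]; have -> : cnt x (dart_elt (e, b)) =
      (sigma (dfrom (e, b)) * chi x
       - sigma (dto (e, b)) * chi (x * dart_elt (e, b))%g
       + (e == a.1)%:R *
         (if b then chi x else - chi (x * dart_elt (e, b))%g))%R.
    rewrite /dart_elt /=; case: b => /=; first exact: cntE.
    rewrite cnt_inv cntE mulgVK; ring.
  rewrite -!addrA; congr (_ + (_ + _))%R; rewrite /chi.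
  case: a {SE chi chiE cntV cntE cntS} => e0 b0.
  rewrite /rev_dart /= !xpair_eqE.
  have [->|_] /= := eqVneq e e0; last by rewrite !mul0r subrr.
  by rewrite /dart_elt; case: b b0 => -[] /=; rewrite ?mulgVK ?mulgK; ring.
- move=> n Sn x.
  have chi_n z : chi (n * z) = chi z.
    by rewrite /chi; case: a.2; rewrite -?mulgA (indE _ _ (Sn _)).
  by split=> [y|v]; [exact: cntS | rewrite chi_n].
Qed.

(** * Paths *)

Implicit Types (u v : vert D) (d : edge D * bool).

(** In a step, the vertex group element is read before the dart. So the path_elt
    of a path ends with a dart, and it is defined up to the vertex group at the
    end of the path. *)
Definition step : Type := (gp * (edge D * bool))%type.
Implicit Types (w : seq step) (a b : step).

Fixpoint gpath u w v : Prop :=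
  if w is a :: w' then [/\ vert_sg u a.1, dfrom a.2 = u & gpath (dto a.2) w' v]
  else u = v.

Lemma gpath_nil u v : gpath u [::] v = (u = v).
Proof. by []. Qed.

Lemma gpath_cons u a w v : gpath u (a :: w) v =
  [/\ vert_sg u a.1, dfrom a.2 = u & gpath (dto a.2) w v].
Proof. by []. Qed.

Definition path_elt w : gp := \prod_(a <- w) (a.1 * dart_elt a.2).

Lemma path_elt_cons a w : path_elt (a :: w) = a.1 * dart_elt a.2 * path_elt w.
Proof. exact: big_cons. Qed.

Lemma path_elt_cat w1 w2 : path_elt (w1 ++ w2) = path_elt w1 * path_elt w2.
Proof. exact: big_cat. Qed.

Lemma path_elt_nil : path_elt [::] = 1.
Proof. exact: big_nil. Qed.

Lemma gpath_cat u w1 w2 v :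
  gpath u (w1 ++ w2) v <-> exists2 x, gpath u w1 x & gpath x w2 v.
Proof.
elim: w1 u => [|a w1 IHw1] u.
  by split=> [uv|[x ->]] //; exists u.
rewrite cat_cons !gpath_cons.
split=> [[ua au /IHw1[x p1 p2]]|[x [ua au p1] p2]]; first by exists x.
by split=> //; apply/IHw1; exists x.
Qed.

Lemma vert_sg_full v (g : vgrp v) : vert_sg v (vm g).
Proof. by exists g. Qed.

Lemma gpath_absorb u w v y e : gpath u w v -> vert_sg v y -> vert_sg u e ->
  exists w' y', [/\ size w' = size w, gpath u w' v, vert_sg v y' &
                   path_elt w' * y' = e * (path_elt w * y)].
Proof.
case: w => [<- vy ve|a w]; last rewrite gpath_cons => -[ua au p] vy ue.
  exists [::], (e * y); split=> //; first exact: sg_mul.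
  by rewrite path_elt_nil !mul1g.
exists ((e * a.1, a.2) :: w), y; rewrite gpath_cons; split=> //.
  by split=> //; exact: (sg_mul ue ua).
by rewrite !path_elt_cons /= !mulgA.
Qed.

Definition joins u v (x : gp) :=
  exists w y, [/\ gpath u w v, vert_sg v y & x = path_elt w * y].

Lemma joins_vert v x : vert_sg v x -> joins v v x.
Proof. by move=> vx; exists [::], x; rewrite path_elt_nil mul1g. Qed.

Lemma joins1 v : joins v v 1.
Proof. by apply: joins_vert; exact: sg_one. Qed.

Lemma joins_mul u v x g h : joins u v g -> joins v x h -> joins u x (g * h).
Proof.
move=> [w [y [p vy ->]]] [w' [y' [p' xy' ->]]].
have [w'' [y'' [_ p'' xy'' E]]] := gpath_absorb p' xy' vy.
exists (w ++ w''), y''; split=> //; first by apply/gpath_cat; exists v.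
by rewrite path_elt_cat -mulgA -E !mulgA.
Qed.

Lemma joins_dart d : joins (dfrom d) (dto d) (dart_elt d).
Proof.
exists [:: (1, d)], 1; split.
- by split=> //; exact: sg_one.
- exact: sg_one.
- by rewrite path_elt_cons path_elt_nil mul1g !mulg1.
Qed.

Lemma joins_tree u v : joins u v 1.
Proof.
have [s + ps] := proj1 T_tree u v.
elim: s u ps => [|d s IHs] u /=; first by move=> /eqP -> _; exact: joins1.
move=> /andP[/eqP <- ps] /andP[dT sT]; rewrite -[1]mulg1.
apply: joins_mul (IHs _ ps sT); have <- : dart_elt d = 1.
  by rewrite /dart_elt stable_letter_tree // invg1 if_same.
exact: joins_dart.
Qed.

(** Since the letters of the maximal tree are trivial, each letter can be
    preceded and followed by paths of the tree without changing its value. *)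
Lemma joins_all v x : joins v v x.
Proof.
rewrite -(pcl_repr x); elim: (repr x) => [|[a b] w IHw]; first exact: joins1.
rewrite -cat1s pcl_cat; apply: joins_mul IHw.
have based u1 u2 g : joins u1 u2 g -> joins v v g.
  move=> ug; rewrite -[g]mul1g -[1 * g]mulg1.
  apply: joins_mul (joins_tree u2 v); exact: joins_mul (joins_tree v u1) ug.
case: a b => [[u g]|e] [].
- have -> : pcl (fg_rel T) [:: (inl (existT _ u g), true)] = (vm g)^-1.
    exact: pcl_neg.
  by apply/(based u u)/joins_vert/sg_inv/vert_sg_full.
- by apply/(based u u)/joins_vert/vert_sg_full.
- have -> : pcl (fg_rel T) [:: (inr e, true)] = (tl e)^-1 by exact: pcl_neg.
  exact: (based _ _ _ (joins_dart (e, false))).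
- exact: (based _ _ _ (joins_dart (e, true))).
Qed.

Definition reduced w := forall w1 a b w2,
  w = w1 ++ a :: b :: w2 -> b.2 = rev_dart a.2 -> ~ edge_sg b.2 b.1.

Lemma reduced_infix w w1 w2 w3 : w = w1 ++ w2 ++ w3 -> reduced w -> reduced w2.
Proof.
move=> -> red v1 a b v2 E; apply: (red (w1 ++ v1) a b (v2 ++ w3)).
by rewrite E -!catA.
Qed.

(** A backtrack through an element of the edge group equals an element of the
    vertex group where the backtrack starts, which the next step absorbs. *)
Lemma gpath_reduce u w v y : gpath u w v -> vert_sg v y ->
  exists w' y', [/\ gpath u w' v, vert_sg v y', reduced w' &
                   path_elt w' * y' = path_elt w * y].
Proof.
have [n] := ubnP (size w); elim: n w y => // n IHn w y lt_wn p vy.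
have [red|] := pselect (reduced w); first by exists w, y.
move=> /existsNP[w1] /existsNP[a] /existsNP[b] /existsNP[w2].
move=> /not_implyP[wE /not_implyP[ba /contrapT eb]].
move: p; rewrite wE => /gpath_cat[x p1].
rewrite !gpath_cons => -[xa ax [ab bE p2]].
have back : dto b.2 = x.
  by rewrite ba dart_to_rev.
have eb' : vert_sg x (a.1 * (dart_elt a.2 * b.1 * dart_elt b.2)).
  apply: sg_mul => //; rewrite -ax; apply: edge_sg_vert.
  have := edge_sgJ eb; rewrite ba rev_dartK dart_elt_rev invgK.
  by rewrite -dart_elt_rev -ba.
move: p2; rewrite back => p2.
have [w3 [y3 [sz3 p3 vy3 E3]]] := gpath_absorb p2 vy eb'.
have [||w' [y' [p' vy' red' E']]] := IHn (w1 ++ w3) y3 _ _ vy3.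
- by move: lt_wn; rewrite wE !size_cat /= sz3 !addnS ltnS => /ltnW.
- by apply/gpath_cat; exists x.
exists w', y'; split=> //; rewrite E' !path_elt_cat !path_elt_cons -mulgA E3.
by rewrite !mulgA.
Qed.


(** * Separating reduced loops from the identity *)

Variables (p : nat) (p_prime : prime p).
Let p_gt1 := prime_gt1 p_prime.

Hypothesis vgrp_RFRp : forall v : vert D, RFRp p (vgrp v).
Hypothesis vgrp_induced : forall v : vert D, induces_rfrp p (@vertex_map D T v).
Hypothesis src_closed : forall e : edge D,
  rfrp_closed p (range (phi_src e : egrp e -> vgrp (src e))).
Hypothesis tgt_closed : forall e : edge D,
  rfrp_closed p (range (phi_tgt e : egrp e -> vgrp (tgt e))).

Local Notation std := (std_filtration p gp).

(** The topology of a vertex group, which is Hausdorff, is induced by that of G;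
    in particular the vertex group embeds in G. *)
Lemma vert_std_trivial v x : vert_sg v x -> (forall i, std i x) -> x = 1.
Proof.
move=> [g _ <-] sx; rewrite (_ : g = 1) ?mult1 //.
apply: (RFRp_std_trivial p_gt1) => // j.
have [i ind] := vgrp_induced v j; exact: ind (sx i).
Qed.

(** Closedness of the edge group yields a level of the filtration of the vertex
    group, and the induced topology then yields a level of that of G. *)
Lemma edge_sg_sep d g : vert_sg (dfrom d) g -> ~ edge_sg d g ->
  exists i, forall c, edge_sg d c -> ~ std i (g * c).
Proof.
have sep v (H : subgroup (vgrp v)) (g0 : vgrp v) : rfrp_closed p (H : set _) ->
    ~ sg_im (@vertex_map D T v) H (vm g0) ->
    exists i, forall c, sg_im (@vertex_map D T v) H c -> ~ std i (vm g0 * c).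
  move=> clH Hg0; have /(rfrp_closed_sep clH)[j sepj] : ~ H g0.
    by move=> ?; apply: Hg0; exists g0.
  have [i ind] := vgrp_induced v j.
  (* Conjugation by c turns g c into c g, the form given by closedness. *)
  exists i => _ [c Hc <-] /(std_normal p_gt1 (vm c)^-1).
  rewrite /conjg invgK mulgK -vertex_mapM => /ind.
  by have := sepj c^-1 (sg_inv Hc); rewrite invgK.
have rangeE (A B : groupType) (f : {multiplicative A -> B}) :
  (sg_im f (sg_full A) : set B) = range f by [].
case: d => e [] [g0 _ <-] /sep; apply; rewrite rangeE; first exact: tgt_closed.
exact: src_closed.
Qed.

(** A sequence has finitely many splittings, so that a property that persists
    from some level on for each of them has a common level. *)
Lemma common_level (X : Type) (s : seq X) (Q : seq X -> X -> nat -> Prop) :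
  (forall s1 x i j, (i <= j)%N -> Q s1 x i -> Q s1 x j) ->
  (forall s1 x s2, s = s1 ++ x :: s2 -> exists i, Q s1 x i) ->
  exists i, forall s1 x s2, s = s1 ++ x :: s2 -> Q s1 x i.
Proof.
elim: s Q => [|y s IHs] Q Qmono Qs; first by exists 0%N => -[].
have [i Qi] := Qs [::] y s erefl.
have [||j Qj] := IHs (fun s1 => Q (y :: s1)).
- by move=> s1 x k l; exact: Qmono.
- by move=> s1 x s2 E; apply: (Qs (y :: s1) x s2); rewrite E.
exists (maxn i j) => -[|z s1] x s2 [<- E].
  exact: Qmono (leq_maxl i j) Qi.
exact: Qmono (leq_maxr i j) (Qj _ _ _ E).
Qed.

(** If the path is closed at a level i where its proper subloops are open and
    where it does not backtrack at its first edge, the count of crossings of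
    that edge shows that it is open at level i.+1. *)
Lemma reduced_loop_sep u w : w <> [::] -> gpath u w u -> reduced w ->
  exists i, forall h, vert_sg u h -> ~ std i (path_elt w * h).
Proof.
have [n] := ubnP (size w); elim: n u w => // n IHn u [//|a w] lt_wn _.
rewrite gpath_cons => -[ua au pw] red.
(* If the dart of b crosses the edge of a again, either it does so in the same
   direction and a :: s1 is closed, or in the opposite direction and s1 is
   closed; when s1 is empty, the latter case is a backtrack. *)
pose Q s1 b i :=
  (b.2 = a.2 -> forall h, vert_sg u h -> ~ std i (path_elt (a :: s1) * h)) /\
  (b.2 = rev_dart a.2 -> forall c, edge_sg (rev_dart a.2) c ->
     ~ std i (path_elt s1 * b.1 * c)).
have [|w1 b w2 wE|i Qi] := @common_level _ w Q.
- move=> s1 b i j ij [Q1 Q2].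
  split=> [/Q1 {}Q1 h uh|/Q2 {}Q2 c ac] /(std_mono ij); first exact: Q1.
  exact: Q2.
- move: pw; rewrite wE => /gpath_cat[x pw1]; rewrite gpath_cons => -[xb bx _].
  have [i1 Q1] : exists i, b.2 = a.2 ->
      forall h, vert_sg u h -> ~ std i (path_elt (a :: w1) * h).
    have [ba|] := pselect (b.2 = a.2); last by exists 0%N.
    have [||||i Qi] := IHn u (a :: w1); rewrite ?gpath_cons //.
    - move: lt_wn; rewrite /= wE size_cat /= addnS ltnS.
      by apply: leq_ltn_trans; rewrite ltnS leq_addr.
    - by split=> //; have <- : x = u by rewrite -au -ba bx.
    - by apply: (reduced_infix (w1 := [::]) (w3 := b :: w2)) red; rewrite wE.
    by exists i.
  have [i2 Q2] : exists i, b.2 = rev_dart a.2 -> forall c,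
      edge_sg (rev_dart a.2) c -> ~ std i (path_elt w1 * b.1 * c).
    have [ba|] := pselect (b.2 = rev_dart a.2); last by exists 0%N.
    have xa : x = dto a.2 by rewrite -bx ba dart_from_rev.
    case: w1 => [|a1 w1] in wE pw1 Q1 *.
      have := edge_sg_sep (d := rev_dart a.2) (g := b.1).
      case=> [||i sep].
      + by rewrite dart_from_rev -xa.
      + by rewrite -ba; apply: (red [::] a b w2) => //; rewrite wE.
      by exists i => _ c; rewrite path_elt_nil mul1g; exact: sep.
    have [||||i Qi] := IHn x (a1 :: w1); rewrite ?gpath_cons //.
    - move: lt_wn; rewrite /= wE size_cat /= !addSn addnS ltnS.
      by apply: leq_ltn_trans; rewrite ltnS leqW ?leq_addr.
    - by move: pw1; rewrite -xa.
    - by apply: (reduced_infix (w1 := [:: a]) (w3 := b :: w2)) red; rewrite wE.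
    exists i => _ c ac; rewrite -mulgA; apply: Qi; apply: sg_mul => //.
    by rewrite -bx ba; exact: edge_sg_vert.
  exists (maxn i1 i2); split=> [/Q1 {}Q1 h uh|/Q2 {}Q2 c ac].
    by move=> /(std_mono (leq_maxl i1 i2)); exact: Q1.
  by move=> /(std_mono (leq_maxr i1 i2)); exact: Q2.
(* The translates of the first edge under std i, given by their positions. *)
pose S : set gp :=
  [set z | exists m c, [/\ std i m, edge_sg a.2 c & z = m * a.1 * c]].
have SE x c : edge_sg a.2 c -> S (x * c) <-> S x.
  move=> ac; split=> -[m [c' [sm ac' E]]]; exists m.
    exists (c' / c); split=> //; first exact: sg_div.
    by rewrite mulgA -E mulgK.
  by exists (c' * c); split=> //; [exact: sg_mul | rewrite E mulgA].
have SN m x : std i m -> S (m * x) <-> S x.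
  move=> sm; split=> -[m' [c [sm' ac E]]].
    exists (m^-1 * m'), c; split=> //.
      by apply: sg_mul => //; exact: sg_inv.
    by rewrite -!mulgA; rewrite -!mulgA in E; rewrite -E mulKg.
  by exists (m * m'), c; split=> //; [exact: sg_mul | rewrite E !mulgA].
have [beta [cnt [cntM cntV cntD cntS]]] := dart_crossing_cocycle SE.
(* A path that avoids S has only the boundary terms of the count. *)
have count w0 x u0 v : gpath u0 w0 v ->
    (forall w1 b w2, w0 = w1 ++ b :: w2 ->
       (b.2 = a.2 -> ~ S (x * path_elt w1 * b.1)) /\
       (b.2 = rev_dart a.2 -> ~ S (x * path_elt w1 * b.1 * dart_elt b.2))) ->
    cnt x (path_elt w0) = (beta u0 x - beta v (x * path_elt w0)%g)%R.
  elim: w0 x u0 => [|b w0 IHw0] x u0.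
    rewrite gpath_nil => -> _; rewrite path_elt_nil mulg1 subrr.
    exact: cocycle1.
  rewrite gpath_cons => -[ub bu pb] Sw; rewrite path_elt_cons !cntM.
  have [Sb Sb'] := Sw [::] b w0 erefl; rewrite path_elt_nil mulg1 in Sb Sb'.
  rewrite (cntV _ u0) // cntD bu (IHw0 _ (dto b.2)) // ?mulgA.
    have -> : ((b.2 == a.2)%:R * indic S (x * b.1)%g = 0)%R.
      have [/Sb/indic0 ->|_] := eqVneq b.2 a.2; first exact: mulr0.
      exact: mul0r.
    have -> : ((b.2 == rev_dart a.2)%:R
               * indic S (x * b.1 * dart_elt b.2)%g = 0)%R.
      have [/Sb'/indic0 ->|_] := eqVneq b.2 (rev_dart a.2); first exact: mulr0.
      exact: mul0r.
    ring.
  move=> w1 b' w2 E; have := Sw (b :: w1) b' w2.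
  by rewrite E path_elt_cons !mulgA; apply.
have avoid w1 b w2 : w = w1 ++ b :: w2 ->
    (b.2 = a.2 -> ~ S (a.1 * dart_elt a.2 * path_elt w1 * b.1)) /\
    (b.2 = rev_dart a.2 ->
       ~ S (a.1 * dart_elt a.2 * path_elt w1 * b.1 * dart_elt b.2)).
  move=> wE; have [Q1 Q2] := Qi _ _ _ wE.
  move: pw; rewrite wE => /gpath_cat[x _]; rewrite gpath_cons => -[xb bx _].
  split=> [ba|ba] [m [c [sm ac E]]].
    apply: (Q1 ba (b.1 * c^-1 * a.1^-1)).
      apply: sg_mul; last exact: sg_inv.
      apply: sg_mul; first by rewrite -au -ba bx.
      by apply: sg_inv; rewrite -au; exact: edge_sg_vert.
    by rewrite path_elt_cons !mulgA E !mulgK.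
  pose g := a.1 * dart_elt a.2.
  apply: (Q2 ba ((dart_elt a.2)^-1 * c * dart_elt a.2)^-1).
    by apply: sg_inv; exact: edge_sgJ.
  have -> : path_elt w1 * b.1 * ((dart_elt a.2)^-1 * c * dart_elt a.2)^-1
            = m ^ g.
    rewrite ba dart_elt_rev in E.
    have {}E : g * (path_elt w1 * b.1) = m * a.1 * c * dart_elt a.2.
      by rewrite -E mulgVK /g !mulgA.
    apply: (mulgI g); rewrite mulgA E /conjg mulVKg !invgM invgK.
    by rewrite -!mulgA !mulVKg.
  exact: std_normal.
exists i.+1 => h uh sh.
set m := path_elt (a :: w) * h in sh.
have sm : std i m by exact: std_step_sub sh.
have cnt_m : cnt 1 m = 1%R.
  have beta_m : beta u m = beta u 1.
    have [_ bm] := cntS m (fun z => SN m z sm) 1.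
    by rewrite -(bm u) mulg1.
  have Sa : S a.1.
    exists 1, 1; split; [exact: sg_one | exact: sg_one |].
    by rewrite mul1g mulg1.
  have a_rev : (a.2 == rev_dart a.2) = false.
    by case: (a.2) => e []; rewrite /rev_dart xpair_eqE andbF.
  rewrite /m path_elt_cons !cntM !mul1g (cntV _ u) // cntD au.
  rewrite (count _ _ _ _ pw) // (cntV _ u) // -path_elt_cons -/m beta_m.
  rewrite eqxx a_rev (indic1 Sa) mul1g.
  rewrite mulr1n mulr0n; ring.
have := @std_step_hom p p_gt1 _ (std i) (cnt 1) _ m sh.
rewrite cnt_m dvdz1 absz_nat => /(_ _)/eqP E.
have {}E : p = 1%N.
  apply: E => x y sx sy; rewrite cntM mul1g -[x in cnt x y]mulg1.
  by have [-> _] := cntS x (fun z => SN x z sx) 1.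
by have := p_gt1; rewrite E.
Qed.

Lemma fundamental_group_std_trivial x : (forall i, std i x) -> x = 1.
Proof.
(* The empty graph is connected: its fundamental group has no generators. *)
move=> sx; have [[v _]|noV] := pselect (exists v : vert D, True); last first.
  rewrite -(pcl_repr x); case: (repr x) => [//|[[[v g]|e] b] w].
    by case: noV; exists v.
  by case: noV; exists (src e).
have [w [y [p1 vy xE]]] := joins_all v x.
have [w' [y' [p' vy' red E]]] := gpath_reduce p1 vy.
have [w0|w0] := pselect (w' = [::]).
  apply: (vert_std_trivial (v := v)) => //.
  by rewrite xE -E w0 path_elt_nil mul1g.
have [i /(_ y' vy')] := reduced_loop_sep w0 p' red.
by rewrite E -xE => /(_ (sx i)).
Qed.

Lemma fundamental_group_fg :
  (forall v : vert D, finitely_generated (vgrp v)) -> finitely_generated gp.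
Proof.
move=> fgV; pose s v := projT1 (cid (fgV v)).
have sgen v : gen [set` s v] = setT :> set _ := projT2 (cid (fgV v)).
exists (flatten [seq [seq vm g | g <- s v] | v <- enum (vert D)] ++
        [seq tl e | e <- enum (edge D)]).
apply/seteqP; split=> // x _ K sK.
have Kv v (g : vgrp v) : K (vm g).
  have : gen [set` s v] g by rewrite sgen.
  move=> /(_ (sg_preim (@vertex_map D T v) K)); apply=> h /= hs.
  apply: sK => /=; rewrite mem_cat; apply/orP; left; apply/flattenP.
  exists [seq vm g | g <- s v]; last exact: map_f.
  by apply: map_f; rewrite mem_enum.
have Ke e : K (tl e).
  apply: sK; rewrite /= mem_cat; apply/orP; right.
  by apply: map_f; rewrite mem_enum.
rewrite -(pcl_repr x); elim: (repr x) => [|[a b] w IHw]; first exact: sg_one.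
rewrite -cat1s pcl_cat; apply: sg_mul IHw.
have Ka : K (pcl (fg_rel T) [:: pos a]).
  by case: a => [[v g]|e]; [exact: Kv | exact: Ke].
case: b => //; have -> : pcl (fg_rel T) [:: (a, true)] = (pcl _ [:: pos a])^-1.
  exact: pcl_neg.
exact: sg_inv.
Qed.


End FundamentalGroupTheory.

Theorem theorem1p3 (p : nat) (p_prime : prime p)
  (D : graph_of_groups) (T : {set edge D}) (T_tree : maximal_tree T)
  (vgrp_fg : forall v : vert D, finitely_generated (vgrp v))
  (egrp_fg : forall e : edge D, finitely_generated (egrp e))
  (vgrp_RFRp : forall v : vert D, RFRp p (vgrp v))
  (vgrp_induced : forall v : vert D, induces_rfrp p (@vertex_map D T v))
  (src_closed : forall e : edge D,
     rfrp_closed p (range (phi_src e : egrp e -> vgrp (src e))))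
  (tgt_closed : forall e : edge D,
     rfrp_closed p (range (phi_tgt e : egrp e -> vgrp (tgt e)))) :
  RFRp p (fundamental_group T).
Proof.
have p_gt1 := prime_gt1 p_prime.
apply: std_trivial_RFRp => //; first exact: fundamental_group_fg.
exact: fundamental_group_std_trivial.
Qed.
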